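(* Let $t$ be a positive even integer. Then, as formal power series in $q$ with coefficients in $\mathbb{Z}[x]$, $$\sum_{\lambda\in \mathcal{SC}} x^{n_t(\lambda)}\, q^{\vert\lambda\vert} = (-q;q^2)_{\infty}\cdot \big((1-x^2)q^{2t};q^{2t}\big)_{\infty}^{t/2}.$$
   Context: A partition $\lambda=(\lambda_1\ge\lambda_2\ge\dots\ge\lambda_\ell\ge 1)$ has size $|\lambda|=\sum_i\lambda_i$ (the empty partition has size $0$). Its Young diagram has $\lambda_i$ left-justified cells in row $i$. The conjugate $\lambda'$ is the partition whose Young diagram is the reflection of that of $\lambda$ in the main diagonal; $\lambda$ is self-conjugate if $\lambda=\lambda'$, and $\mathcal{SC}$ denotes the set of all self-conjugate partitions (including the empty one). The hook length of the cell $(i,j)$ in the Young diagram of $\lambda$ is the number of cells directly to its right in row $i$, plus the number of cells directly below it in column $j$, plus $1$. For a positive integer $t$, $n_t(\lambda)$ is the number of cells of $\lambda$ whose hook length equals $t$. The $q$-Pochhammer symbol is $(a;q)_0=1$, $(a;q)_n=\prod_{j=0}^{n-1}(1-aq^j)$ for $n\ge1$, and $(a;q)_\infty=\prod_{j\ge0}(1-aq^j)$. *)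

(* Defs.v *)
From HB Require Import structures.
From mathcomp Require Import all_boot all_order all_algebra.
Set Implicit Arguments. Unset Strict Implicit. Unset Printing Implicit Defensive.
Import Order.TTheory GRing.Theory Num.Theory.

Definition is_partition (s : seq nat) : bool :=
  sorted geq s && all (fun x => 0 < x) s.

Definition psize (s : seq nat) : nat := sumn s.

Definition pconj (s : seq nat) : seq nat :=
  mkseq (fun j => count (fun x => j < x) s) (head 0 s).

Definition self_conj (s : seq nat) : bool := pconj s == s.

(* hook length of cell (i,j) (0-indexed, j < lambda_i):
   arm (lambda_i - j - 1) + leg (lambda'_j - i - 1) + 1 *)
Definition hook (s : seq nat) (i j : nat) : nat :=
  (nth 0 s i - j - 1) + (nth 0 (pconj s) j - i - 1) + 1.

Definition n_hook (t : nat) (s : seq nat) : nat :=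
  \sum_(i < size s) \sum_(j < nth 0 s i) (hook s i j == t).

(* A finite family of sequences containing every partition of n
   (at most n parts, each at most n). *)
Definition cand (n : nat) : seq (seq nat) :=
  undup [seq [seq x <- map val (fgraph f) | 0 < x] | f : {ffun 'I_n -> 'I_n.+1}].

Local Open Scope ring_scope.

Definition sc_coef (t n : nat) : {poly int} :=
  \sum_(s <- cand n | [&& is_partition s, psize s == n & self_conj s])
     'X ^+ (n_hook t s).

Definition qpoch (R : comNzRingType) (a : {poly R}) (k N : nat) : {poly R} :=
  \prod_(j < N) (1 - a * 'X ^+ (k * j)).

(* Main.v *)
Require Import Defs.
From HB Require Import structures.
From mathcomp Require Import all_boot all_order all_algebra.
From mathcomp Require Import zify ring.
Import Order.TTheory GRing.Theory Num.Theory.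
Set Implicit Arguments. Unset Strict Implicit. Unset Printing Implicit Defensive.

(** A self-conjugate partition is a finite set [D] of naturals: [a] is in [D]
    when [2 a + 1] is the length of a principal hook. Its Maya diagram has, at
    [b >= 0], a bead when [D b], and, at [- 1 - e], a bead when not [D e]; cells
    of hook length [t] are the beads that can jump down by [t]. The diagram
    splits into the residue classes mod [t], and since [t] is even the symmetry
    exchanges [r] and [t - 1 - r] without fixed class: the classes [r < t / 2]
    are arbitrary independent words, and each jump in them counts twice.

    With weights [u_p] for a bead and [w_p] for a gap, and [1 + v] for each gap
    followed by a bead, words of length [m] have a generating function [T_m]
    such that [T_(m+2) = (u + w)_(m+1) T_(m+1) + v u_(m+1) w_m T_m]. In the
    geometric case this is solved by
      [T_m = sum_j v^j Q^(j(j+1)/2) (prod_(i < j) u_i) (prod_(m-j <= i < m) w_i)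
             [m-j choose j]_Q (prod_(j <= i < m-j) (u_i + w_i))],
    which for a long centred window tends to
      [prod (u_i + w_i) * sum_j v^j Q^(j(j+1)/2) / (Q; Q)_j
       = prod (u_i + w_i) * prod_(k >= 1) (1 + v Q^k)].
    Take [Q = q^(2t)] and [1 + v = x^2]. *)

(** * Self-conjugate partitions *)

(** Self-conjugacy as symmetry of the set of cells. It also forces the rows to decrease, since
    column [i] is then an initial segment of length [nth 0 s i]. *)
Definition diag_sym (s : seq nat) :=
  forall i j, (i < nth 0 s j) = (j < nth 0 s i).

Lemma ltn_inj m n : (forall i, (i < m) = (i < n)) -> m = n.
Proof. by move=> eq_mn; have := eq_mn m; have := eq_mn n; lia. Qed.

Lemma nth_gt0 s i : all (fun x => 0 < x) s -> (0 < nth 0 s i) = (i < size s).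
Proof.
move=> /(all_nthP 0) s_gt0; case: (ltnP i (size s)) => [/s_gt0 //|le_si].
by rewrite nth_default.
Qed.

Lemma pos_seq_inj s1 s2 :
  all (fun x => 0 < x) s1 -> all (fun x => 0 < x) s2 ->
  nth 0 s1 =1 nth 0 s2 -> s1 = s2.
Proof.
move=> s1_gt0 s2_gt0 eq12; apply: (@eq_from_nth _ 0) => [|i _]; last exact: eq12.
by apply: ltn_inj => i; rewrite -!nth_gt0 // eq12.
Qed.

(** In a decreasing list the entries above [j] form a prefix. *)
Lemma count_gt_sorted s j : sorted geq s ->
  forall i, (i < count (fun x => j < x) s) = (j < nth 0 s i).
Proof.
elim: s => [_ i|x s IHs]; first by rewrite nth_nil.
rewrite /= => ss i; have {}IHs := IHs (path_sorted ss).
case: (ltnP j x) => [lt_jx|le_xj]; first by case: i => //= i; rewrite add1n ltnS.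
rewrite add0n IHs.
have small k : nth 0 s k <= j.
  have [lt_ks|le_sk] := ltnP k (size s); last by rewrite nth_default.
  move: ss; rewrite path_sortedE; last by move=> a b c; rewrite /geq; lia.
  by case/andP=> /allP/(_ _ (mem_nth 0 lt_ks)); rewrite /geq /=; lia.
case: i => [|i] /=; first by have := small 0; lia.
by have := small i; have := small i.+1; lia.
Qed.

Lemma nth_pconj s i j : sorted geq s ->
  (i < nth 0 (pconj s) j) = (j < nth 0 s i).
Proof.
move=> ss; rewrite -(count_gt_sorted _ ss) /pconj.
have [lt_js|le_sj] := ltnP j (head 0 s); first by rewrite nth_mkseq.
rewrite nth_default ?size_mkseq //; symmetry; apply/negbTE; rewrite -leqNgt.
by have := count_gt_sorted j ss 0; rewrite nth0; lia.
Qed.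

Lemma self_conjP s :
  reflect (all (fun x => 0 < x) s /\ diag_sym s) (is_partition s && self_conj s).
Proof.
apply: (iffP andP) => [[/andP[ss s_gt0] /eqP conj_s]|[s_gt0 sym_s]].
  by split=> // i j; rewrite -(nth_pconj _ _ ss) conj_s.
have ss : sorted geq s.
  apply/(sortedP 0) => i lt_is; rewrite /geq /=; have := sym_s (nth 0 s i).
  move=> /(_ i); have := sym_s (nth 0 s i) i.+1; lia.
rewrite /is_partition ss s_gt0; split=> //; apply/eqP.
apply: (@eq_from_nth _ 0); first rewrite size_mkseq -nth0.
  by apply: ltn_inj => i; rewrite sym_s nth_gt0.
by move=> j _; apply: ltn_inj => i; rewrite nth_pconj // sym_s.
Qed.

(* Adds to a Young diagram a new principal hook of arm and leg length [a]. *)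
Definition add_hook (a : nat) (s : seq nat) : seq nat :=
  a.+1 :: [seq x.+1 | x <- s] ++ nseq (a - size s) 1.

Lemma size_add_hook a s : size s <= a -> size (add_hook a s) = a.+1.
Proof. by move=> le_sa; rewrite /= size_cat size_map size_nseq subnKC. Qed.

Lemma nth_add_hook a s i : size s <= a ->
  nth 0 (add_hook a s) i.+1 = if i < a then (nth 0 s i).+1 else 0.
Proof.
move=> le_sa; rewrite /= nth_cat size_map.
have [lt_is|le_si] := ltnP i (size s).
  by rewrite (nth_map 0) // (leq_trans lt_is le_sa).
by rewrite nth_nseq ltn_sub2rE // (nth_default 0 le_si).
Qed.

Lemma add_hook_gt0 a s :
  all (fun x => 0 < x) s -> all (fun x => 0 < x) (add_hook a s).
Proof.
by move=> s_gt0; rewrite /= all_cat all_nseq orbT andbT all_map; apply/allP.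
Qed.

Lemma diag_sym_add_hook a s :
  size s <= a -> diag_sym s -> diag_sym (add_hook a s).
Proof.
move=> le_sa sym_s [|i] [|j] //; rewrite ?nth_add_hook //=; try by case: ifP; lia.
have small k l : l < nth 0 s k -> k < a.
  by case: (ltnP k (size s)) => [|?]; [lia | rewrite nth_default].
by have := small i j; have := small j i; have := sym_s i j; do 2!case: ifP; lia.
Qed.

Lemma psize_add_hook a s :
  size s <= a -> psize (add_hook a s) = psize s + a.*2.+1.
Proof.
move=> le_sa; rewrite /psize /= sumn_cat sumn_nseq mul1n.
have -> : sumn [seq x.+1 | x <- s] = sumn s + size s.
  by elim: s {le_sa} => //= x s ->; lia.
lia.
Qed.

Lemma n_hook_self_conj t s : self_conj s ->
  n_hook t s = \sum_(i < size s) \sum_(j < nth 0 s i)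
    ((nth 0 s i - j - 1) + (nth 0 s j - i - 1) + 1 == t).
Proof. by rewrite /n_hook /hook => /eqP ->. Qed.

(** The old cells move one step along the diagonal and keep their hooks. The new corner has hook
    [2 a + 1]; the cell [j + 1] of the new row has hook [nth 0 s j + a - j], and so has its mirror
    image, hence the doubling. *)
Lemma n_hook_add_hook t a s :
  all (fun x => 0 < x) s -> diag_sym s -> size s <= a ->
  n_hook t (add_hook a s) =
  n_hook t s + (a.*2.+1 == t) + (\sum_(j < a) (nth 0 s j + a == t + j)).*2.
Proof.
move=> s_gt0 sym_s le_sa.
have/andP[_ conj_s] : is_partition s && self_conj s by apply/self_conjP.
have/andP[_ conj_as] : is_partition (add_hook a s) && self_conj (add_hook a s).
  by apply/self_conjP; split; [apply: add_hook_gt0 | apply: diag_sym_add_hook].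
rewrite !n_hook_self_conj // size_add_hook // big_ord_recl /=.
rewrite big_ord_recl /= -[X in _ = _ + X]addnn.
have -> : a.+1 - 0 - 1 + (a.+1 - 0 - 1) + 1 = a.*2.+1 by lia.
under eq_bigr => j _.
  rewrite (_ : bump 0 j = j.+1) //.
  rewrite -[(nth 0 (_ ++ _) j)]/(nth 0 (add_hook a s) j.+1).
  rewrite nth_add_hook // ltn_ord.
  have -> : (a.+1 - j.+1 - 1 + ((nth 0 s j).+1 - 0 - 1) + 1 == t)
     = (nth 0 s j + a == t + j) by have := ltn_ord j; lia.
  over.
under [X in _ + X]eq_bigr => i _.
  rewrite (_ : bump 0 i = i.+1) //.
  rewrite -[(nth 0 (_ ++ _) i)]/(nth 0 (add_hook a s) i.+1).
  rewrite nth_add_hook // ltn_ord big_ord_recl /=.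
  have -> : ((nth 0 s i).+1 - 0 - 1 + (a.+1 - i.+1 - 1) + 1 == t)
     = (nth 0 s i + a == t + i) by have := ltn_ord i; lia.
  under eq_bigr => j _.
    rewrite (_ : bump 0 j = j.+1) //.
    rewrite -[(nth 0 (_ ++ _) j)]/(nth 0 (add_hook a s) j.+1).
    rewrite nth_add_hook //.
    have -> : j < a.
      have : 0 < nth 0 s j by rewrite (@leq_ltn_trans i) // sym_s ltn_ord.
      by rewrite nth_gt0 // => /leq_trans; apply.
    rewrite !subSS; over.
  over.
rewrite big_split /=.
have -> : \sum_(i < a) \sum_(j < nth 0 s i)
    (nth 0 s i - j - 1 + (nth 0 s j - i - 1) + 1 == t) =
  \sum_(i < size s) \sum_(j < nth 0 s i)
    (nth 0 s i - j - 1 + (nth 0 s j - i - 1) + 1 == t).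
  rewrite [RHS](big_ord_widen_cond a xpredT (fun i => \sum_(j < nth 0 s i)
    (nth 0 s i - j - 1 + (nth 0 s j - i - 1) + 1 == t) : nat)) // [RHS]big_mkcond.
  apply: eq_bigr => i _; case: ltnP => // le_si.
  by rewrite nth_default // big_ord0.
by move: (\sum_(j < a) _) (\sum_(i < size s) _) (nat_of_bool _) => x y z; lia.
Qed.

(* The self-conjugate partition whose principal hooks have lengths [2 a + 1]
   for the [a < n] with [D a]. *)
Fixpoint sc_of (D : nat -> bool) (n : nat) : seq nat :=
  if n is m.+1 then if D m then add_hook m (sc_of D m) else sc_of D m else [::].

Lemma eq_sc_of D D' n : (forall i, i < n -> D i = D' i) -> sc_of D n = sc_of D' n.
Proof.
by elim: n => //= n IHn eqD; rewrite eqD // IHn // => i /ltnW; apply: eqD.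
Qed.

Lemma size_sc_of D n : size (sc_of D n) <= n.
Proof.
elim: n => //= n IHn; case: (D n); last exact: leqW.
by rewrite size_add_hook.
Qed.

Lemma sc_of_gt0 D n : all (fun x => 0 < x) (sc_of D n).
Proof. by elim: n => //= n IHn; case: (D n) => //; apply: add_hook_gt0. Qed.

Lemma diag_sym_sc_of D n : diag_sym (sc_of D n).
Proof.
elim: n => [|n IHn] /=; first by move=> i j; rewrite !nth_nil.
by case: (D n) => //; apply: diag_sym_add_hook; rewrite ?size_sc_of.
Qed.

Lemma psize_sc_of D n : psize (sc_of D n) = \sum_(a < n | D a) a.*2.+1.
Proof.
elim: n => [|n IHn]; first by rewrite big_ord0.
rewrite big_mkcond big_ord_recr -big_mkcond /= -IHn.
case: (D n); last by rewrite addn0.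
by rewrite psize_add_hook ?size_sc_of.
Qed.

(** Peeling off the outer hook: if the first column has length [n + 1], so has the first row, and
    [n] must belong to [D]. *)
Lemma sc_of_surj s n :
  all (fun x => 0 < x) s -> diag_sym s -> size s <= n -> exists D, s = sc_of D n.
Proof.
elim: n s => [|n IHn] s s_gt0 sym_s le_sn.
  by exists xpred0; move: le_sn; rewrite leqn0 size_eq0 => /eqP.
have [lt_ns|] := ltnP n (size s); last first.
  case/(IHn s s_gt0 sym_s) => D ->; exists (fun i => (i != n) && D i) => /=.
  by rewrite eqxx; apply: eq_sc_of => i lt_in; rewrite ltn_eqF.
have s0 : nth 0 s 0 = n.+1.
  by apply: ltn_inj => i; rewrite sym_s nth_gt0 //; congr (_ < _); lia.
(* Rows of length 1 vanish with the outer hook; by symmetry [(nth 0 s 1).-1] of the rows after the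
   first are longer. *)
pose s' := mkseq (fun i => (nth 0 s i.+1).-1) (nth 0 s 1).-1.
have s'E i : nth 0 s' i = (nth 0 s i.+1).-1.
  have [lt_is|le_si] := ltnP i (nth 0 s 1).-1; first by rewrite nth_mkseq.
  by rewrite nth_default ?size_mkseq //; have := sym_s i.+1 1; lia.
have s'_gt0 : all (fun x => 0 < x) s'.
  apply/(all_nthP 0) => i; rewrite size_mkseq s'E.
  by have := sym_s i.+1 1; lia.
have sym_s' : diag_sym s'.
  by move=> i j; rewrite !s'E; have := sym_s i.+1 j.+1; lia.
have le_s'n : size s' <= n.
  have := sym_s n.+1 1; rewrite size_mkseq (@nth_default _ _ _ n.+1) //; lia.
have [D Ds'] := IHn s' s'_gt0 sym_s' le_s'n.
exists (fun i => (i == n) || D i) => /=; rewrite eqxx.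
rewrite (_ : sc_of _ n = s'); last first.
  by rewrite Ds'; apply: eq_sc_of => i lt_in; rewrite ltn_eqF.
apply: (pos_seq_inj s_gt0 (add_hook_gt0 n s'_gt0)) => -[//|i].
rewrite nth_add_hook // s'E; have := nth_gt0 i.+1 s_gt0.
by case: (ltnP i n); lia.
Qed.

(** Row [j] gives the bead [nth 0 s j - j - 1] of the Maya diagram; this reads off the beads at
    [b >= 0]. *)
Lemma sc_of_arm D n b :
  \sum_(j < n) (nth 0 (sc_of D n) j == j + b.+1) = (b < n) && D b.
Proof.
elim: n => [|n IHn] /=; first by rewrite big_ord0.
case: ifP => Dn.
  rewrite big_ord_recl [nth _ _ _]/=.
  under eq_bigr => j _ do
    rewrite lift0 nth_add_hook ?size_sc_of // ltn_ord addSn eqSS.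
  by rewrite IHn /=; case: (ltngtP b n) => [||->]; rewrite ?Dn; lia.
rewrite big_ord_recr /= IHn nth_default ?size_sc_of //.
by case: (ltngtP b n) => [||->]; rewrite ?Dn; lia.
Qed.

(** The same for the bead position [- 1 - e]; rows of length 0 give beads too. *)
Lemma sc_of_leg D n e : e < n ->
  \sum_(j < n) (nth 0 (sc_of D n) j + e == j) = ~~ D e.
Proof.
have large s m : m <= e -> \sum_(j < m) (nth 0 s j + e == j) = 0.
  by move=> le_me; rewrite big1 // => j _; have := ltn_ord j; lia.
elim: n => // n IHn; rewrite ltnS => le_en /=; case: ifP => Dn.
  rewrite big_ord_recl [nth _ _ _]/=.
  under eq_bigr => j _ do
    rewrite lift0 nth_add_hook ?size_sc_of // ltn_ord addSn eqSS.
  move: le_en; rewrite leq_eqVlt => /orP[/eqP eq_en|/IHn -> //].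
  by rewrite large ?eq_en ?Dn.
rewrite big_ord_recr /= nth_default ?size_sc_of // add0n.
move: le_en; rewrite leq_eqVlt => /orP[/eqP eq_en|lt_en].
  by rewrite large ?eq_en ?eqxx ?Dn.
by rewrite IHn // ltn_eqF // addn0.
Qed.

Lemma sc_of_inj D D' n :
  sc_of D n = sc_of D' n -> forall i, i < n -> D i = D' i.
Proof.
move=> eqD i lt_in; have := sc_of_arm D n i; rewrite eqD sc_of_arm lt_in /=.
by case: (D i); case: (D' i).
Qed.

(* Whether the bead [a] of the Maya diagram of [D] can jump down by [t]: the
   negative positions [- 1 - e] are occupied exactly when [D e] fails. *)
Definition t_hook (t : nat) (D : nat -> bool) (a : nat) : bool :=
  D a && if t <= a then ~~ D (a - t) else (t - a.+1 < a) && D (t - a.+1).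

(** Diagonal hooks are odd, hence never equal to [t]; the other cells pair up with their mirror
    images. *)
Lemma n_hook_sc_of t D n : 0 < t -> ~~ odd t ->
  n_hook t (sc_of D n) = (\sum_(a < n) t_hook t D a).*2.
Proof.
move=> t_gt0 t_even; elim: n => [|n IHn]; first by rewrite /n_hook !big_ord0.
rewrite big_ord_recr doubleD -IHn /= /t_hook; case: (D n); last by rewrite addn0.
rewrite n_hook_add_hook ?sc_of_gt0 ?size_sc_of //; last exact: diag_sym_sc_of.
rewrite -addnA; congr (_ + _); have -> : (n.*2.+1 == t) = false.
  by apply: contraNF t_even => /eqP <-; rewrite /= odd_double.
(* A hook of length [t] in the outer row means a bead at [t - n - 1], a negative position exactly
   when [t <= n]. *)
rewrite add0n /=; congr _.*2; case: (leqP t n) => [le_tn|lt_nt].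
  rewrite -(@sc_of_leg D n); last by lia.
  by apply: eq_bigr => j _; lia.
by rewrite -sc_of_arm; apply: eq_bigr => j _; lia.
Qed.

Local Open Scope ring_scope.

(** * Words with marked ascents *)

Section QBinomial.
Variables (R : comNzRingType) (Q : R).

Fixpoint qbin (n k : nat) : R :=
  match n, k with
  | _, 0 => 1
  | 0, _.+1 => 0
  | n'.+1, k'.+1 => qbin n' k' + Q ^+ k * qbin n' k
  end.

Lemma qbin0 n : qbin n 0 = 1.
Proof. by case: n. Qed.

Lemma qbinS n k : qbin n.+1 k.+1 = qbin n k + Q ^+ k.+1 * qbin n k.+1.
Proof. by []. Qed.

Lemma qbin_small n k : (n < k)%N -> qbin n k = 0.
Proof.
elim: n k => [|n IHn] [|k] //= lt_nk.
by rewrite !IHn ?mulr0 ?addr0 // ltnW.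
Qed.

(** The dual Pascal rule. Truncation of [n - k] is harmless, as [qbin n k] vanishes for [k > n]. *)
Lemma qbinS_sym n k : qbin n.+1 k.+1 = qbin n k.+1 + Q ^+ (n - k) * qbin n k.
Proof.
elim: n k => [|n IHn] [|k]; rewrite qbinS.
- by rewrite !qbin0 /= expr0; ring.
- by rewrite !qbin_small //; ring.
- by rewrite {1}IHn [in RHS]qbinS !qbin0 !subn0 !exprS; ring.
rewrite [in LHS]IHn [in LHS](IHn k.+1) [in RHS]qbinS [in RHS](qbinS n k) subSS.
have [lt_nk|le_kn] := ltnP n k.+1; first by rewrite (qbin_small lt_nk); ring.
have -> : (n - k = (n - k.+1).+1)%N by lia.
by rewrite !exprS; ring.
Qed.

(** Multiplying by the last factor is the dual Pascal rule. The free bound [K] allows a termwise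
    comparison with a longer sum. *)
Lemma qbinomial_theorem (v : R) n K : (n <= K)%N ->
  \prod_(k < n) (1 + v * Q ^+ k.+1) =
  \sum_(j < K.+1) v ^+ j * Q ^+ 'C(j.+1, 2) * qbin n j.
Proof.
pose F m j := v ^+ j * Q ^+ 'C(j.+1, 2) * qbin m j.
have F_rec m j : F m.+1 j.+1 = F m j.+1 + F m j * (v * Q ^+ m.+1).
  rewrite /F; have [lt_mj|le_jm] := ltnP m j.
    by rewrite !qbin_small ?mulr0 ?mul0r ?addr0 //; lia.
  rewrite qbinS_sym binS bin1 exprD.
  have -> : Q ^+ m.+1 = Q ^+ (m - j) * Q ^+ j.+1.
    by rewrite -exprD; congr (_ ^+ _); lia.
  by rewrite (exprS v j); ring.
rewrite -[RHS]/(\sum_(j < K.+1) F n j); elim: n K => [|n IHn] K.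
  rewrite big_ord0 big_ord_recl big1 => [|j _]; last by rewrite /F mulr0.
  by rewrite /F /= !expr0 !mul1r addr0.
case: K => // K le_nK; rewrite big_ord_recr /= mulrDr mulr1.
rewrite {1}(IHn K.+1) 1?ltnW // big_ord_recl (IHn K) // [RHS]big_ord_recl.
under [X in _ = _ + X]eq_bigr => j _ do rewrite F_rec //.
by rewrite big_split /= -mulr_suml addrA /F !qbin0.
Qed.

End QBinomial.

(** * Binary words and their generating function *)

Definition ext n (f : {ffun 'I_n -> bool}) (i : nat) : bool :=
  if insub i is Some j then f j else false.

Lemma extE n (f : {ffun 'I_n -> bool}) (i : 'I_n) : ext f i = f i.
Proof. by rewrite /ext valK. Qed.

Lemma ext_finfun n (D : 'I_n -> bool) i (lt_in : (i < n)%N) :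
  ext (finfun D) i = D (Ordinal lt_in).
Proof. by rewrite (extE _ (Ordinal lt_in)) ffunE. Qed.

(** Splits off the last letter. The hypothesis on [g] stands in for function extensionality. *)
Lemma sum_ext_recr (R : nmodType) n (g : (nat -> bool) -> R) :
  (forall D D', (forall i, (i <= n)%N -> D i = D' i) -> g D = g D') ->
  \sum_(f : {ffun 'I_n.+1 -> bool}) g (ext f) =
  \sum_(f : {ffun 'I_n -> bool}) \sum_b g (fun i => if i == n then b else ext f i).
Proof.
move=> g_ext; rewrite pair_bigA /=.
pose hd (f : {ffun 'I_n.+1 -> bool}) := [ffun i : 'I_n => ext f i].
pose rc (x : {ffun 'I_n -> bool} * bool) :=
  [ffun i : 'I_n.+1 => if i == n :> nat then x.2 else ext x.1 i].
rewrite (reindex rc) /=.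
  apply: eq_bigr => [[f b] _]; apply: g_ext => i le_in.
  by rewrite /rc ext_finfun.
exists (fun f => (hd f, f ord_max)) => [[f b] _|f _].
  rewrite /rc /hd /= !ffunE eqxx; congr (_, _); apply/ffunP => i.
  have lt_in := leqW (ltn_ord i).
  by rewrite ffunE ext_finfun /= ltn_eqF ?extE.
apply/ffunP => i; rewrite ffunE /=; case: eqP => [eq_in|ne_in].
  by congr (f _); apply: val_inj.
have lt_in : (i < n)%N by have := ltn_ord i; lia.
by rewrite ext_finfun extE.
Qed.

Lemma prod_nat_shift (R : comNzRingType) (w : nat -> R) m n : (m <= n)%N ->
  (\prod_(m <= i < n) w i) * w n = w m * \prod_(m.+1 <= i < n.+1) w i.
Proof.
move=> le_mn; transitivity (\prod_(m <= i < n.+1) w i).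
  by rewrite big_nat_recr.
by rewrite big_ltn.
Qed.

Section Words.
Variables (R : comNzRingType) (Q v : R) (u w : nat -> R).

Definition word_weight (D : nat -> bool) (p : nat) : R :=
  if D p then u p * (if (0 < p)%N && ~~ D p.-1 then 1 + v else 1) else w p.

Definition word_sum n : R :=
  \sum_(f : {ffun 'I_n -> bool}) \prod_(p < n) word_weight (ext f) p.

Lemma word_sum0 : word_sum 0 = 1.
Proof.
rewrite /word_sum (eq_bigr (fun=> 1)) => [|f _]; last by rewrite big_ord0.
by rewrite sumr_const card_ffun card_ord expn0.
Qed.

Lemma word_weight_ext D D' n : (forall i, (i <= n)%N -> D i = D' i) ->
  forall p, (p <= n)%N -> word_weight D p = word_weight D' p.
Proof.
move=> eqD p le_pn; rewrite /word_weight eqD // (eqD p.-1) //.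
exact: leq_trans (leq_pred _) le_pn.
Qed.

Lemma word_sum_recr (g : (nat -> bool) -> R) n :
  (forall D D', (forall i, (i <= n)%N -> D i = D' i) -> g D = g D') ->
  \sum_(f : {ffun 'I_n.+1 -> bool})
     (\prod_(p < n) word_weight (ext f) p) * g (ext f) =
  \sum_(f : {ffun 'I_n -> bool}) (\prod_(p < n) word_weight (ext f) p) *
     \sum_b g (fun i => if i == n then b else ext f i).
Proof.
move=> g_ext.
rewrite (sum_ext_recr (g := fun D => (\prod_(p < n) word_weight D p) * g D)).
  apply: eq_bigr => f _; rewrite mulr_sumr; apply: eq_bigr => b _; congr (_ * _).
  apply: eq_bigr => p _; apply: (@word_weight_ext _ _ p) => // i le_ip.
  by rewrite ltn_eqF // (leq_ltn_trans le_ip).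
move=> D D' eqD; rewrite (g_ext _ _ eqD); congr (_ * _); apply: eq_bigr => p _.
by apply: (@word_weight_ext _ _ n) => //; apply: ltnW.
Qed.

Lemma word_sumS n : word_sum n.+1 =
  \sum_(f : {ffun 'I_n -> bool}) (\prod_(p < n) word_weight (ext f) p) *
     (u n * (if (0 < n)%N && ~~ ext f n.-1 then 1 + v else 1) + w n).
Proof.
rewrite /word_sum; under eq_bigr => f _ do rewrite big_ord_recr /=.
rewrite (word_sum_recr (g := fun D => word_weight D n)).
  apply: eq_bigr => f _; rewrite big_bool /word_weight eqxx; congr (_ * (_ + _)).
  by case: (ltnP 0 n) => //= n_gt0; rewrite ltn_eqF // ltn_predL.
by move=> D D' eqD; apply: (word_weight_ext eqD).
Qed.

Lemma word_sum1 : word_sum 1 = u 0 + w 0.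
Proof.
by rewrite word_sumS /= -mulr_suml -/(word_sum 0) word_sum0 mul1r mulr1.
Qed.

(** In the mark [1 + v], the term 1 leaves the last letter free, while [v] forces the word to end in
    a gap followed by a bead. *)
Lemma word_sumSS n : word_sum n.+2 =
  (u n.+1 + w n.+1) * word_sum n.+1 + v * u n.+1 * w n * word_sum n.
Proof.
rewrite word_sumS /= [word_sum n.+1]/word_sum mulr_sumr.
under eq_bigr => f _.
  rewrite (_ : _ * _ = (u n.+1 + w n.+1) * \prod_(p < n.+1) word_weight (ext f) p
    + (\prod_(p < n) word_weight (ext f) p) *
      (v * u n.+1 * (if ext f n then 0 else w n))); last first.
    by rewrite big_ord_recr /= {2 4}/word_weight; case: (ext f n) => /=; ring.
  over.
rewrite big_split /=; congr (_ + _).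
rewrite (word_sum_recr (g := fun D => v * u n.+1 * (if D n then 0 else w n))).
  rewrite [word_sum n]/word_sum mulr_sumr; apply: eq_bigr => f _.
  by rewrite big_bool /= eqxx; ring.
by move=> D D' /(_ n) ->.
Qed.

(** The ratios [u_p / w_p] are geometric with ratio [Q], stated without division. *)
Hypothesis uw : forall m n, (m <= n)%N -> u n * w m = Q ^+ (n - m) * w n * u m.

Definition word_term n j : R :=
  Q ^+ 'C(j.+1, 2) * (\prod_(i < j) u i) * (\prod_(n - j <= i < n) w i) *
  qbin Q (n - j) j * \prod_(j <= i < n - j) (u i + w i).

Lemma word_term_small n j : (n < j.*2)%N -> word_term n j = 0.
Proof. by move=> ?; rewrite /word_term qbin_small ?mulr0 ?mul0r //; lia. Qed.

Lemma word_term0 n : word_term n 0 = \prod_(i < n) (u i + w i).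
Proof.
by rewrite /word_term subn0 big_geq // big_ord0 qbin0 expr0 !mul1r big_mkord.
Qed.

Lemma qbinn k : qbin Q k k = 1.
Proof.
by elim: k => // k IHk; rewrite qbinS IHk qbin_small // mulr0 addr0.
Qed.

(** The hypothesis [uw] brings all products to a common factor; what remains is one Pascal rule for
    the coefficient of [u m] and the dual one for that of [w m], where [m = n - j]. *)
Lemma word_term_rec n j : word_term n.+2 j.+1 =
  (u n.+1 + w n.+1) * word_term n.+1 j.+1 + u n.+1 * w n * word_term n j.
Proof.
have [?|] := ltnP n j.*2; first by rewrite !word_term_small ?mulr0 ?addr0 //; lia.
(* If [n = 2 j], the term for [n + 1] and [j + 1] vanishes and the middle products of the two others
   are empty. *)
rewrite leq_eqVlt => /orP[/eqP <-|lt_jn].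
  rewrite (@word_term_small j.*2.+1) ?doubleS // mulr0 add0r /word_term.
  have -> : (j.*2.+2 - j.+1 = j.+1)%N by lia.
  have -> : (j.*2 - j = j)%N by lia.
  have uw_j : u j.*2.+1 * w j = Q ^+ j.+1 * w j.*2.+1 * u j.
    by rewrite uw; [congr (Q ^+ _ * _ * _) |]; lia.
  have w_shift : (\prod_(j <= i < j.*2) w i) * w j.*2 =
      w j * \prod_(j.+1 <= i < j.*2.+1) w i.
    by rewrite prod_nat_shift //; lia.
  rewrite (big_geq (leqnn j.+1)) (big_geq (leqnn j)) !qbinn !mulr1.
  rewrite binS bin1 exprD big_ord_recr /=.
  rewrite (big_nat_recr j.*2.+1) /=; last by lia.
  transitivity (Q ^+ 'C(j.+1, 2) * (\prod_(i < j) u i) * (u j.*2.+1 * w j) *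
    \prod_(j.+1 <= i < j.*2.+1) w i); first by rewrite uw_j; ring.
  by rewrite -!mulrA -w_shift; ring.
have [m -> lt_jm] : exists2 m, n = (m + j)%N & (j < m)%N by exists (n - j)%N; lia.
rewrite /word_term; set n' := (m + j)%N.
have -> : (n'.+2 - j.+1 = m.+1)%N by lia.
have -> : (n'.+1 - j.+1 = m)%N by lia.
have -> : (n' - j = m)%N by lia.
have uw_m : u n'.+1 * w m = Q ^+ j.+1 * w n'.+1 * u m.
  by rewrite uw; [congr (Q ^+ _ * _ * _) |]; lia.
have uw_j : u n'.+1 * w j = Q ^+ (m - j) * Q ^+ j.+1 * w n'.+1 * u j.
  by rewrite uw -?exprD; [congr (Q ^+ _ * _ * _) |]; lia.
have w_shift : (\prod_(m <= i < n') w i) * w n' =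
    w m * \prod_(m.+1 <= i < n'.+1) w i.
  by rewrite prod_nat_shift //; lia.
have -> : \prod_(m <= i < n'.+1) w i = w m * \prod_(m.+1 <= i < n'.+1) w i.
  by rewrite big_ltn //; lia.
rewrite [\prod_(j <= i < m) _]big_ltn //.
rewrite [\prod_(m.+1 <= i < _.+2) _]big_nat_recr /=; last by lia.
rewrite [\prod_(j.+1 <= i < m.+1) _]big_nat_recr //= binS bin1 exprD big_ord_recr /=.
move: w_shift; set W1 := \prod_(m <= i < n') w i.
set W := \prod_(m.+1 <= i < n'.+1) w i.
set U := \prod_(i < j) u i; set S := \prod_(j.+1 <= i < m) _ => w_shift.
pose K := Q ^+ 'C(j.+1, 2) * U * W * S.
(* The last factor [u m + w m] of the middle product is split, so that each half can use its own
   Pascal rule. *)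
transitivity (K * Q ^+ j.+1 * u j * w n'.+1 *
  ((qbin Q m j + Q ^+ j.+1 * qbin Q m j.+1) * u m +
   (qbin Q m j.+1 + Q ^+ (m - j) * qbin Q m j) * w m)).
  by rewrite -qbinS -qbinS_sym /K; ring.
transitivity (K * (Q ^+ j.+1 * u j * qbin Q m j.+1 * (u n'.+1 * w m) +
  Q ^+ j.+1 * u j * w m * w n'.+1 * qbin Q m j.+1 +
  u j * qbin Q m j * (u n'.+1 * w m) + w m * qbin Q m j * (u n'.+1 * w j))).
  by rewrite uw_m uw_j /K; ring.
transitivity ((u n'.+1 + w n'.+1) * (Q ^+ 'C(j.+1, 2) * Q ^+ j.+1 * (U * u j) *
   (w m * W) * qbin Q m j.+1 * S) +
  u n'.+1 * (Q ^+ 'C(j.+1, 2) * U * (W1 * w n') * qbin Q m j * ((u j + w j) * S))).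
  by rewrite w_shift /K; ring.
ring.
Qed.

(** Both sides satisfy the same two-step recurrence with the same initial values. *)
Lemma word_sumE n K : (n <= K)%N ->
  word_sum n = \sum_(j < K.+1) v ^+ j * word_term n j.
Proof.
elim/ltn_ind: n => -[|[|n]] IHn in K *.
- rewrite word_sum0 big_ord_recl word_term0 big_ord0 big1 ?mulr1 ?addr0 // => j _.
  by rewrite word_term_small ?mulr0 // lift0.
- rewrite word_sum1 big_ord_recl word_term0 big_ord1 big1 ?mul1r ?addr0 // => j _.
  by rewrite word_term_small ?mulr0 // lift0.
case: K => // K lt_nK.
have lt_nK' := ltnW lt_nK.
rewrite word_sumSS (IHn n.+1 (ltnSn _) K.+1) // (IHn n (leqnSn _) K) //.
rewrite big_ord_recl [RHS]big_ord_recl mulrDr !word_term0 -addrA; congr (_ + _).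
  by rewrite [in RHS]big_ord_recr /=; ring.
rewrite !mulr_sumr -big_split /=; apply: eq_bigr => j _.
rewrite (_ : bump 0 j = j.+1) // word_term_rec exprS; ring.
Qed.
End Words.

(** * Summation over self-conjugate partitions *)

(** There are at most [n] parts, each at most [n]; padding by zeros gives the values of a function,
    and the filter removes the padding. *)
Lemma mem_cand s n :
  all (fun x => 0 < x)%N s -> (psize s <= n)%N -> s \in cand n.
Proof.
move=> s_gt0 le_sn.
have [le_size le_nth] : (size s <= n)%N /\ forall i, (nth 0 s i <= n)%N.
  move: s_gt0 le_sn; rewrite /psize; elim: s n => [|x s IHs] n /=.
    by split=> // i; rewrite nth_nil.
  move=> /andP[x_gt0 s_gt0] le_xsn.
  have [|le_size le_nth] := IHs (n - x)%N s_gt0; first by lia.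
  by split=> [|[|i]] /=; [lia | lia | have := le_nth i; lia].
rewrite mem_undup; apply/imageP; exists [ffun i : 'I_n => inord (nth 0%N s i)] => //.
have -> : map val (fgraph [ffun i : 'I_n => inord (nth 0%N s i) : 'I_n.+1]) =
    s ++ nseq (n - size s) 0%N.
  apply: (@eq_from_nth _ 0%N) => [|i].
    by rewrite size_map size_tuple card_ord size_cat size_nseq subnKC.
  move=> lt_i; have {lt_i} lt_in : (i < n)%N.
    by move: lt_i; rewrite size_map size_tuple card_ord.
  rewrite (nth_map ord0) ?size_tuple ?card_ord //.
  rewrite (nth_fgraph_ord _ (Ordinal lt_in)) ffunE /= inordK ?ltnS ?le_nth //.
  rewrite nth_cat; case: ltnP => // le_si.
  by rewrite nth_default // nth_nseq if_same.
rewrite filter_cat; have /all_filterP -> := s_gt0.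
suff -> k : [seq x <- nseq k 0%N | (0 < x)%N] = [::] by rewrite cats0.
by elim: k.
Qed.

(** Trades partitions for subsets of the first [M] naturals: a partition of [n] has at most [n <= M]
    parts, so it is some [sc_of D M]. *)
Lemma sc_coef_sum t n M : (n <= M)%N ->
  sc_coef t n = \sum_(f : {ffun 'I_M -> bool} | psize (sc_of (ext f) M) == n)
    'X ^+ n_hook t (sc_of (ext f) M).
Proof.
move=> le_nM; rewrite /sc_coef -big_filter -[RHS]big_filter.
rewrite -(big_map (fun f => sc_of (ext f) M) xpredT (fun s => 'X ^+ n_hook t s)).
apply: perm_big; apply: uniq_perm.
- by rewrite filter_uniq ?undup_uniq.
- rewrite map_inj_uniq ?filter_uniq ?index_enum_uniq // => f f' eq_sc.
  apply/ffunP => i; rewrite -!extE.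
  exact: (sc_of_inj eq_sc (ltn_ord i)).
move=> s; rewrite mem_filter; apply/idP/mapP => [|[f]].
  move=> /andP[/and3P[part_s size_s conj_s] _].
  have /self_conjP[s_gt0 sym_s] : is_partition s && self_conj s by apply/andP.
  have le_sM : (size s <= M)%N.
    apply: leq_trans le_nM; rewrite -(eqP size_s) /psize.
    elim: (s) s_gt0 => //= x s' IHs /andP[x_gt0 /IHs]; lia.
  have [D Ds] := sc_of_surj s_gt0 sym_s le_sM.
  have eq_sc : sc_of (ext [ffun i : 'I_M => D i]) M = s.
    by rewrite Ds; apply: eq_sc_of => i lt_iM; rewrite ext_finfun.
  exists [ffun i : 'I_M => D i]; last by rewrite eq_sc.
  by rewrite mem_filter eq_sc size_s mem_index_enum.
rewrite mem_filter => /andP[size_s _] ->.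
have /andP[-> ->] : is_partition (sc_of (ext f) M) && self_conj (sc_of (ext f) M).
  by apply/self_conjP; split; [apply: sc_of_gt0 | apply: diag_sym_sc_of].
by rewrite size_s mem_cand ?sc_of_gt0 // (eqP size_s).
Qed.

(** The factor of [a] in the summand of [D]; [y] will be [x^2], as each jump accounts for two
    cells. *)
Definition site_weight (R : comNzRingType) (y : {poly R}) t D a : {poly R} :=
  (if D a then 'X ^+ a.*2.+1 else 1) * y ^+ t_hook t D a.

Lemma sc_coefE t n M : (0 < t)%N -> ~~ odd t -> (n <= M)%N ->
  sc_coef t n = (\sum_(f : {ffun 'I_M -> bool})
    \prod_(a < M) site_weight ('X ^+ 2 : {poly int})%:P t (ext f) a)`_n.
Proof.
move=> t_gt0 t_even /sc_coef_sum ->; rewrite coef_sum big_mkcond.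
apply: eq_bigr => f _; rewrite /site_weight big_split /= prodrXr.
rewrite -polyC_exp coefMC -big_mkcond prodrXr -psize_sc_of coefXn eq_sym.
by case: eqP => _; rewrite ?mul0r // mul1r -exprM n_hook_sc_of // mul2n.
Qed.

(** * Splitting the Maya diagram into residue classes *)

Section Runners.
Variables (t h N : nat).
Hypotheses (t_double : t = h.*2) (h_gt0 : (0 < h)%N) (N_gt0 : (0 < N)%N).

(* The [p]-th bead of runner [r] sits at [b = r + t (p - N)]; this is its
   distance to the centre of the diagram, [b] or [- 1 - b]. *)
Definition bead_pos (r p : nat) : nat :=
  if (N <= p)%N then (r + t * (p - N))%N else (t - r.+1 + t * (N - p.+1))%N.

Lemma bead_pos_lt r p : (r < h)%N -> (p < N.*2)%N -> (bead_pos r p < t * N)%N.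
Proof. by rewrite /bead_pos => ? ?; case: ifP => ?; nia. Qed.

(** Residues [r < h] and [t - 1 - r >= h] mod [t] tell apart the two sides of the centre. *)
Lemma bead_pos_inj r p r' p' : (r < h)%N -> (r' < h)%N ->
  bead_pos r p = bead_pos r' p' -> (p < N.*2)%N -> (p' < N.*2)%N ->
  r = r' /\ p = p'.
Proof.
have div_uniq a b k l : (a < t)%N -> (b < t)%N ->
    (a + t * k = b + t * l)%N -> a = b /\ k = l.
  clear => lt_at lt_bt eq_ab.
  suff eq_kl : k = l by move: eq_ab; rewrite eq_kl => /addIn.
  by case: (ltngtP k l) => // ?; nia.
rewrite /bead_pos => lt_rh lt_r'h; case: (leqP N p) => ?; case: (leqP N p') => ?.
- by case/div_uniq; lia.
- by case/div_uniq; lia.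
- by case/div_uniq; lia.
- by case/div_uniq; lia.
Qed.

Definition bead_ord (x : 'I_h * 'I_N.*2) : 'I_(t * N) :=
  Ordinal (bead_pos_lt (ltn_ord x.1) (ltn_ord x.2)).

Lemma bead_ord_bij : bijective bead_ord.
Proof.
apply: inj_card_bij => [[r p] [r' p'] /(congr1 val) /= eq_pos|].
  have [] := bead_pos_inj (ltn_ord r) (ltn_ord r') eq_pos (ltn_ord p) (ltn_ord p').
  by move=> eq_r eq_p; congr (_, _); apply: val_inj.
by rewrite card_prod !card_ord; nia.
Qed.

Lemma prod_runners (R : comNzRingType) (F : nat -> R) :
  \prod_(a < t * N) F a = \prod_(r < h) \prod_(p < N.*2) F (bead_pos r p).
Proof.
rewrite pair_bigA /= (reindex bead_ord) //.
exact: onW_bij bead_ord_bij.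
Qed.

Variables (R : comNzRingType) (v : {poly R}).

(** Below the centre it is a gap that puts its position into [D], so there the gap carries the power
    of [q] and the bead has weight 1. *)
Definition wt_full r p : {poly R} :=
  if (N <= p)%N then 'X ^+ (bead_pos r p).*2.+1 else 1.

Definition wt_empty r p : {poly R} :=
  if (N <= p)%N then 1 else 'X ^+ (bead_pos r p).*2.+1.

(** On both sides of the centre the ratio of the weights is [q^(2 (r + t (p - N)) + 1)], with a
    signed exponent: geometric of ratio [q^(2t)]. *)
Lemma wt_full_empty r m n : (r < h)%N -> (m <= n)%N ->
  wt_full r n * wt_empty r m =
  'X ^+ (2 * t) ^+ (n - m) * wt_empty r n * wt_full r m.
Proof.
move=> lt_rh le_mn; rewrite /wt_full /wt_empty /bead_pos.
case: (leqP N m) => [le_Nm|lt_mN].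
  rewrite (leq_trans le_Nm le_mn) !mulr1 -exprM -exprD; congr ('X ^+ _).
  by nia.
case: (leqP N n) => [le_Nn|lt_nN].
  by rewrite !mulr1 -exprM -exprD; congr ('X ^+ _); nia.
by rewrite mul1r mulr1 -exprM -exprD; congr ('X ^+ _); nia.
Qed.

Definition ascent (g : nat -> bool) p := [&& g p, 0 < p & ~~ g p.-1]%N.

(** A jump from [p + 1] to [p] is charged to the end farther from the centre: the gap below the
    centre, the bead above it. The jump across the centre is charged to [N - 1], which leaves
    nothing at [N]. *)
Lemma t_hook_runner r D g : (r < h)%N ->
  (forall p, (p < N.*2)%N -> D (bead_pos r p) = g p (+) (p < N)%N) ->
  forall p, (p < N.*2)%N -> t_hook t D (bead_pos r p) =
  if (p < N)%N then ascent g p.+1 else (p != N) && ascent g p.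
Proof.
move=> lt_rh Dg p lt_p; rewrite /t_hook /ascent Dg //.
case: (ltnP p N) => [lt_pN|le_Np].
  rewrite /= addbT; have [lt_SpN|le_NSp] := ltnP p.+1 N.
    have -> : (t <= bead_pos r p)%N by rewrite /bead_pos; case: ifP; nia.
    have -> : (bead_pos r p - t = bead_pos r p.+1)%N.
      by rewrite /bead_pos; do 2!case: ifP; nia.
    by rewrite Dg ?lt_SpN; [case: (g p); case: (g p.+1) | lia].
  have eq_pN : p.+1 = N by lia.
  have -> : bead_pos r p = (t - r.+1)%N by rewrite /bead_pos; case: ifP; nia.
  have -> : (t <= t - r.+1)%N = false by lia.
  have -> : (t - (t - r.+1).+1 = r)%N by lia.
  have -> : (r < t - r.+1)%N by lia.
  have := Dg N; rewrite /bead_pos leqnn subnn muln0 addn0 ltnn addbF eq_pN => -> /=.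
    by case: (g p); case: (g N).
  by lia.
rewrite addbF; have [->|ne_pN] /= := eqVneq p N.
  rewrite /bead_pos leqnn subnn muln0 addn0 ifF; last by lia.
  by rewrite ltnNge (_ : r <= _)%N ?andbF //; lia.
have -> : (t <= bead_pos r p)%N by rewrite /bead_pos le_Np; nia.
have -> : (bead_pos r p - t = bead_pos r p.-1)%N.
  by rewrite /bead_pos le_Np ifT; nia.
rewrite Dg; last by lia.
have -> : (p.-1 < N)%N = false by lia.
by rewrite addbF (_ : 0 < p)%N //; lia.
Qed.

Lemma prod_site_weight r D g : (r < h)%N ->
  (forall p, (p < N.*2)%N -> D (bead_pos r p) = g p (+) (p < N)%N) ->
  \prod_(p < N.*2) site_weight (1 + v) t D (bead_pos r p) =
  \prod_(p < N.*2) word_weight v (wt_full r) (wt_empty r) g p.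
Proof.
move=> lt_rh Dg; rewrite /site_weight big_split /=.
transitivity ((\prod_(p < N.*2) (if g p then wt_full r p else wt_empty r p)) *
   \prod_(p < N.*2) (1 + v) ^+ ascent g p); last first.
  rewrite -big_split; apply: eq_bigr => p _; rewrite /word_weight /ascent /=.
  by case: (g p) => /=; [case: ifP; rewrite ?expr1 | rewrite mulr1].
congr (_ * _).
  apply: eq_bigr => p _; rewrite Dg // /wt_full /wt_empty ltnNge.
  by case: (g p); case: leqP.
pose F p := (1 + v) ^+ t_hook t D (bead_pos r p).
rewrite -(big_mkord xpredT F) -(big_mkord xpredT (fun p => (1 + v) ^+ ascent g p)).
(* Positions below [N] account for the ascents at 1 to [N], those above [N] for the later ones;
   position [N] and the ascent at 0 contribute 1. *)
rewrite (big_cat_nat (n := N)) //=; last by lia.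
rewrite (big_ltn (m := N)) /=; last by lia.
rewrite [RHS]big_ltn /=; last by lia.
rewrite [\prod_(1 <= i < N.*2) _](big_cat_nat (n := N.+1)) //=; last by lia.
have -> : F N = 1 by rewrite /F (t_hook_runner lt_rh Dg) ?ltnn ?eqxx //; lia.
rewrite /ascent andbF expr0 !mul1r [\prod_(1 <= i < N.+1) _]big_add1 /=; congr (_ * _).
  apply: eq_big_nat => p /andP[_ lt_pN].
  by rewrite /F (t_hook_runner lt_rh Dg) ?lt_pN //; lia.
apply: eq_big_nat => p /andP[lt_Np lt_p].
rewrite /F (t_hook_runner lt_rh Dg) // ifF; last by lia.
by rewrite gtn_eqF.
Qed.

Lemma sum_runners :
  \sum_(f : {ffun 'I_(t * N) -> bool})
    \prod_(a < t * N) site_weight (1 + v) t (ext f) a =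
  \prod_(r < h) word_sum v (wt_full r) (wt_empty r) N.*2.
Proof.
rewrite /word_sum bigA_distr_bigA /=.
have [inv ordK invK] := bead_ord_bij.
(* Membership in [D] means a bead above the centre but a gap below it. *)
pose flip (p : 'I_N.*2) := (p < N)%N.
pose glue (G : {ffun 'I_h -> {ffun 'I_N.*2 -> bool}}) :=
  [ffun a => G (inv a).1 (inv a).2 (+) flip (inv a).2].
rewrite (reindex glue) /=; last first.
  exists (fun f => [ffun r => [ffun p => f (bead_ord (r, p)) (+) flip p]]) => [G _|f _].
    by apply/ffunP => r; apply/ffunP => p; rewrite !ffunE ordK addbK.
  apply/ffunP => a; rewrite !ffunE; case E: (inv a) => [r p] /=.
  by rewrite -E invK addbK.
apply: eq_bigr => G _.
rewrite (prod_runners (fun a => site_weight (1 + v) t (ext (glue G)) a)).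
apply: eq_bigr => r _; apply: prod_site_weight => // p lt_p.
rewrite (extE _ (bead_ord (r, Ordinal lt_p))) ffunE ordK /=.
by rewrite (extE _ (Ordinal lt_p)).
Qed.

End Runners.

(** * The limit *)

Section Truncation.
Variables (R : comNzRingType) (n : nat).
Implicit Types p q : {poly R}.

Definition eq_upto p q := forall i, (i <= n)%N -> p`_i = q`_i.

Lemma eq_upto_trans p q r : eq_upto p q -> eq_upto q r -> eq_upto p r.
Proof. by move=> pq qr i le_in; rewrite pq ?qr. Qed.

Lemma eq_uptoD p p' q q' :
  eq_upto p q -> eq_upto p' q' -> eq_upto (p + p') (q + q').
Proof. by move=> pq pq' i le_in; rewrite !coefD pq ?pq'. Qed.

Lemma eq_uptoM p p' q q' :
  eq_upto p q -> eq_upto p' q' -> eq_upto (p * p') (q * q').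
Proof.
move=> pq pq' i le_in; rewrite !coefM; apply: eq_bigr => j _.
by rewrite pq ?pq' ?(leq_trans (leq_subr _ _)) // (leq_trans _ le_in) // -ltnS.
Qed.

Lemma eq_upto_sum (I : Type) (s : seq I) (P : pred I) (F G : I -> {poly R}) :
  (forall i, P i -> eq_upto (F i) (G i)) ->
  eq_upto (\sum_(i <- s | P i) F i) (\sum_(i <- s | P i) G i).
Proof.
by move=> FG; apply: (big_ind2 (R1 := {poly R}) eq_upto) => // *; apply: eq_uptoD.
Qed.

Lemma eq_upto_prod (I : Type) (s : seq I) (P : pred I) (F G : I -> {poly R}) :
  (forall i, P i -> eq_upto (F i) (G i)) ->
  eq_upto (\prod_(i <- s | P i) F i) (\prod_(i <- s | P i) G i).
Proof.
by move=> FG; apply: (big_ind2 (R1 := {poly R}) eq_upto) => // *; apply: eq_uptoM.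
Qed.

Lemma eq_upto_Xn k p : (n < k)%N -> eq_upto ('X^k * p) 0.
Proof.
by move=> lt_nk i le_in; rewrite coefXnM (leq_ltn_trans le_in lt_nk) coef0.
Qed.

Lemma eq_upto_1Xn k : (n < k)%N -> eq_upto (1 + 'X^k) 1.
Proof.
move=> lt_nk i le_in; rewrite coefD coefXn ltn_eqF ?addr0 //.
exact: leq_ltn_trans lt_nk.
Qed.

Lemma eq_upto_prod1 a b (F : nat -> {poly R}) :
  (forall i, (a <= i < b)%N -> eq_upto (F i) 1) ->
  eq_upto (\prod_(a <= i < b) F i) 1.
Proof.
move=> F1.
apply: (@eq_upto_trans _ (\prod_(a <= i < b) 1)); last by rewrite big1_eq.
rewrite [X in eq_upto X]big_nat [X in eq_upto _ X]big_nat.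
exact: eq_upto_prod.
Qed.

(** By the dual Pascal rule, each further row changes the coefficient by a multiple of a power of
    [q] beyond [n]. *)
Lemma eq_upto_qbin s m N j : (0 < s)%N -> (n + j < N)%N -> (N <= m)%N ->
  eq_upto (qbin 'X^s m j) (qbin 'X^s N j).
Proof.
case: j => [|j] s_gt0 lt_nN; first by rewrite !qbin0.
elim: m => [|m IHm] le_Nm; first by lia.
move: le_Nm; rewrite leq_eqVlt => /orP[/eqP -> //|lt_Nm].
apply: eq_upto_trans (IHm _); last by lia.
rewrite qbinS_sym -[X in eq_upto _ X]addr0; apply: eq_uptoD => //.
by rewrite -exprM; apply: eq_upto_Xn; nia.
Qed.

End Truncation.

(** * Long centred windows *)

Section Limit.
Variables (t h N n : nat) (R : comNzRingType) (v : {poly R}).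
Hypotheses (t_double : t = h.*2) (h_gt0 : (0 < h)%N) (lt_nN : (n.*2 < N)%N).

Let odd_factor a : {poly R} := 1 + 'X^(a.*2.+1).

(** The closed form and the q-binomial theorem are compared term by term in [j]; for [j > n] both
    terms are divisible by [q^(n+1)]. *)
Lemma word_sum_upto r : (r < h)%N ->
  eq_upto n (word_sum v (wt_full t N R r) (wt_empty t N R r) N.*2)
    (\prod_(p < N.*2) odd_factor (bead_pos t N r p) *
     \prod_(k < N) (1 + v * 'X^(2 * t) ^+ k.+1)).
Proof.
move=> lt_rh.
have uw m k : (m <= k)%N -> wt_full t N R r k * wt_empty t N R r m =
    'X^(2 * t) ^+ (k - m) * wt_empty t N R r k * wt_full t N R r m.
  by apply: (@wt_full_empty _ h) => //; lia.
rewrite (word_sumE v uw (leqnn _)).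
have le_N2N : (N <= N.*2)%N by lia.
rewrite (qbinomial_theorem _ _ le_N2N) mulr_sumr; apply: eq_upto_sum => j _.
have wt_odd p :
    wt_full t N R r p + wt_empty t N R r p = odd_factor (bead_pos t N r p).
  by rewrite /wt_full /wt_empty /odd_factor; case: ifP; rewrite // addrC.
rewrite /word_term; under [X in v ^+ j * (_ * X)]eq_bigr => p _ do rewrite wt_odd.
have [lt_nj|le_jn] := ltnP n j.
  have lt_n : (n < 2 * t * 'C(j.+1, 2))%N by rewrite binS bin1; nia.
  apply: (@eq_upto_trans _ _ _ 0).
    rewrite -exprM -!mulrA mulrCA; exact: eq_upto_Xn.
  move=> i le_in; symmetry; move: i le_in.
  rewrite -/(eq_upto _ _ _) -exprM [v ^+ j * _]mulrC mulrCA -!mulrA.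
  exact: eq_upto_Xn.
(* As [j <= n < N], the first [j] positions lie below the centre, where beads weigh 1, and the last
   [j] above it, where gaps weigh 1. *)
rewrite [\prod_(i < j) _]big1 => [|i _]; last first.
  by rewrite /wt_full ifF //; have := ltn_ord i; lia.
rewrite [\prod_(_ <= i < N.*2) _]big1_seq => [|i]; last first.
  by rewrite mem_index_iota => /andP[_ /andP[? ?]]; rewrite /wt_empty ifT //; lia.
rewrite !mulr1.
set S := \prod_(j <= i < _) _.
rewrite (_ : _ * (_ * S) = S * (v ^+ j * 'X^(2 * t) ^+ 'C(j.+1, 2) *
  qbin 'X^(2 * t) (N.*2 - j) j)); last by ring.
apply: eq_uptoM; last by apply: eq_uptoM => //; apply: eq_upto_qbin; lia.
rewrite -(big_mkord xpredT (fun p => odd_factor (bead_pos t N r p))).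
rewrite (@big_cat_nat _ _ _ j 0 N.*2) //=; last by lia.
rewrite (@big_cat_nat _ _ _ (N.*2 - j) j N.*2) //=; try lia.
(* The factors missing at both ends of the window sit so far from the centre that they are 1 modulo
   [q^(n+1)]. *)
suff upto_S : eq_upto n (1 * (S * 1))
   (\prod_(0 <= i < j) odd_factor (bead_pos t N r i) *
    (S * \prod_(N.*2 - j <= i < N.*2) odd_factor (bead_pos t N r i))).
  by move: upto_S; rewrite mul1r mulr1.
have upto_sym (p : {poly R}) : eq_upto n p 1 -> eq_upto n 1 p.
  by move=> p1 i le_in; rewrite p1.
apply: eq_uptoM; last apply: eq_uptoM => //; apply: upto_sym.
  apply: eq_upto_prod1 => i /andP[_ ?]; apply: eq_upto_1Xn.
  by rewrite /bead_pos ifF; [nia | lia].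
apply: eq_upto_prod1 => i /andP[? ?]; apply: eq_upto_1Xn.
by rewrite /bead_pos ifT; [nia | lia].
Qed.

(** The odd factors of all runners together run over every [a < t N]; those with [a >= N] are 1
    modulo [q^(n+1)]. *)
Lemma sum_runners_upto :
  eq_upto n (\sum_(f : {ffun 'I_(t * N) -> bool})
      \prod_(a < t * N) site_weight (1 + v) t (ext f) a)
    (\prod_(a < N) odd_factor a *
     (\prod_(k < N) (1 + v * 'X^(2 * t) ^+ k.+1)) ^+ h).
Proof.
have N_gt0 : (0 < N)%N by lia.
rewrite (sum_runners t_double h_gt0 N_gt0 v).
apply: (@eq_upto_trans _ _ _ (\prod_(a < t * N) odd_factor a *
     (\prod_(k < N) (1 + v * 'X^(2 * t) ^+ k.+1)) ^+ h)).
  rewrite (prod_runners t_double h_gt0 N_gt0) -[h in _ ^+ h]card_ord -prodr_const.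
  rewrite -big_split.
  by apply: eq_upto_prod => r _; apply: word_sum_upto.
apply: eq_uptoM => //; rewrite -(big_mkord xpredT odd_factor).
rewrite (big_cat_nat (n := N)) //=; last by nia.
rewrite big_mkord -[X in eq_upto _ _ X]mulr1; apply: eq_uptoM => //.
by apply: eq_upto_prod1 => i /andP[? _]; apply: eq_upto_1Xn; lia.
Qed.

End Limit.

(* Identity of formal power series in q over Z[x] (x = 'X of {poly int},
   q = 'X of {poly {poly int}}): for every n, the q^n-coefficient of the
   infinite product is the q-adic limit of the coefficients of the finite
   truncations of the products. *)
Theorem theorem1p1 (t : nat) (t_pos : (0 < t)%N) (t_even : ~~ odd t) :
  forall n : nat, exists N0 : nat, forall N : nat, (N0 <= N)%N ->
    sc_coef t n =
    (qpoch (- 'X) 2 N *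
     (qpoch ((1 - 'X ^+ 2 : {poly int})%:P * 'X ^+ (2 * t)) (2 * t) N)
       ^+ (t %/ 2))`_n.
Proof.
(* The bound [2 n < N] gives [n + j < N] for all [j <= n], as the stabilisation of the Gaussian
   binomials requires. *)
move=> n; exists n.*2.+1 => N lt_nN.
pose h := t./2.
have t_double : t = h.*2 by rewrite /h; lia.
have h_gt0 : (0 < h)%N by lia.
pose v : {poly {poly int}} := ('X ^+ 2)%:P - 1.
(* The window [t N] is tiled exactly by [h] runners of length [2 N]. *)
rewrite (@sc_coefE t n (t * N)) //; last by nia.
have -> : ('X ^+ 2 : {poly int})%:P = 1 + v by rewrite addrC subrK.
rewrite (@sum_runners_upto t h N n _ v t_double h_gt0 lt_nN) // divn2 -/h.
congr (nth 0 (polyseq (_ * _ ^+ _)) n); apply: eq_bigr => k _.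
  by rewrite mulNr opprK -exprS mul2n.
(* The initial [q^(2t)] of the Pochhammer symbol shifts the exponent of [Q = q^(2t)] from [k] to
   [k + 1]. *)
rewrite polyCB polyC1 (exprM _ (2 * t)) (exprS 'X^(2 * t)) /v.
by move: ('X^2)%:P => c; ring.
Qed.
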